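(* Let $f:\mathbb{R}^n\to\mathbb{R}$ be continuously differentiable, and let $\{x_k\}$ be an infinite sequence generated by Algorithm TBB (in any of its six variants) from $x_0$. Write $G(x)=\nabla^2f(x)$. Suppose that (a) $\{x_k\}$ converges to a local minimum $x^*$ of $f$, and $x_k\ne x^*$ for all $k$; (b) the level set $L(x_0)=\{x\in\mathbb{R}^n:f(x)\le f(x_0)\}$ is bounded; (c) $f$ is twice continuously differentiable in a neighborhood of $x^*$, and there exist $\varepsilon>0$ and $M>m>0$ such that, whenever $\|x-x^*\|<\varepsilon$, $m\|y\|^2\le y^TG(x)y\le M\|y\|^2$ for all $y\in\mathbb{R}^n$; (d) $G$ is Lipschitz continuous in a neighborhood of $x^*$. Then $\{x_k\}$ converges superlinearly to $x^*$ if and only if $$\lim_{k\to\infty}\frac{\left\|\left(\frac{1}{\lambda_k\bar\alpha_k}I_n-G(x^* )\right)(x_{k+1}-x_k)\right\|}{\|x_{k+1}-x_k\|}=0.$$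
   Context: Superlinear convergence of $\{x_k\}$ to $x^*$ means $\lim_{k\to\infty}\|x_{k+1}-x^*\|/\|x_k-x^*\|=0$. $I_n$ is the $n\times n$ identity matrix. Algorithm TBB (three-point step size gradient method with relaxed generalized Armijo step size rule). Write $g_k=\nabla f(x_k)$. Parameters: $\mu_1,\mu_2\in(0,1)$ with $\mu_1\le\mu_2$; $\gamma_1,\gamma_2>0$; $\sigma_1\in(0,1)$; $\sigma_2\in(1,2)$; $0<\alpha_{\min}<\alpha_{\max}$; $0<\omega<1$. Start from $x_{-1}=x_0\in\mathbb{R}^n$ and $\bar\alpha_0=1$, $k=0$. At iteration $k$: (1) If $g_k=0$, stop; otherwise set $d_k=-\bar\alpha_k g_k$. (2) Choose a number $L_k$ with $0\le L_k\le \bar\alpha_k(-g_k^Td_k)/\|d_k\|^2$. Set $x_{k+1}=x_k+\lambda_kd_k$ with $\lambda_k=\omega^{p_k}$, where $p_k$ is the smallest non-negative integer for which $\lambda_k$ satisfies both (a) $f(x_k+\lambda_kd_k)\le f(x_k)+\mu_1\lambda_k\left(g_k^Td_k+\frac{1}{2\bar\alpha_k}L_k\|d_k\|^2\right)$, and (b) $\lambda_k\ge\gamma_1$, or $\lambda_k\ge\gamma_2\lambda_k^*>0$ for some $\lambda_k^*$ with $f(x_k+\lambda_k^*d_k)>f(x_k)+\mu_2\lambda_k^*\left(g_k^Td_k+\frac{1}{2\bar\alpha_k}L_k\|d_k\|^2\right)$. (3) Replace $k$ by $k+1$. With $s_{k-1}=x_k-x_{k-1}$, $s_{k-2}=x_k-x_{k-2}$,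 $y_{k-1}=g_k-g_{k-1}$, $y_{k-2}=g_k-g_{k-2}$, let $\beta_k=\frac{s_{k-1}^Ty_{k-1}}{\|y_{k-1}\|^2}$ and let $\alpha_k$ be given by one fixed choice among the following six formulas (one per variant): BB1: $\alpha_k=\alpha_k^{BB_1}:=\frac{\|s_{k-1}\|^2}{s_{k-1}^Ty_{k-1}}$; BB2: $\alpha_k=\alpha_k^{BB_2}:=\frac{s_{k-1}^Ty_{k-1}}{\|y_{k-1}\|^2}$; TBB1: $\alpha_k=\frac{\|s_{k-1}\|^2+\|s_{k-2}\|^2}{s_{k-1}^Ty_{k-1}+s_{k-2}^Ty_{k-2}}$; TBB2: $\alpha_k=\frac{s_{k-1}^Ty_{k-1}+s_{k-2}^Ty_{k-2}}{\|y_{k-1}\|^2+\|y_{k-2}\|^2}$; TBB1$'$: $\alpha_k=\lambda\alpha_k^{BB_1}+(1-\lambda)\alpha_k^{BB_2}$ with $\lambda=\left(\frac{\|s_{k-2}\|^2}{y_{k-2}^Ts_{k-2}}-\alpha_k^{BB_2}\right)/(\alpha_k^{BB_1}-\alpha_k^{BB_2})$; TBB2$'$: $\alpha_k=\lambda\alpha_k^{BB_1}+(1-\lambda)\alpha_k^{BB_2}$ with $\lambda=\left(\frac{y_{k-2}^Ts_{k-2}}{\|y_{k-2}\|^2}-\alpha_k^{BB_2}\right)/(\alpha_k^{BB_1}-\alpha_k^{BB_2})$. Put $\bar\alpha_{\min}=\max\{\alpha_{\min},\sigma_1|\beta_k|\}$ and $\bar\alpha_{\max}=\min\{\alpha_{\max},\sigma_2|\beta_k|\}$.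 Set $\bar\alpha_k=\alpha_k$ if $\bar\alpha_{\min}\le\alpha_k\le\bar\alpha_{\max}$; $\bar\alpha_k=\bar\alpha_{\min}$ if $\alpha_k<\bar\alpha_{\min}$; $\bar\alpha_k=\bar\alpha_{\max}$ if $\alpha_k>\bar\alpha_{\max}$. Return to (1). Standing assumptions: all quantities above are well defined at every iteration and the algorithm does not stop, so that $\{x_k\}$ is infinite; $\alpha_{\min}\le\beta_k\le\alpha_{\max}$ for all $k\ge1$, and $\alpha_{\min}\le 1\le\alpha_{\max}$. (Consequently $\alpha_{\min}\le\bar\alpha_k\le\alpha_{\max}$ for all $k$.) *)

(* Defs.v *)
From HB Require Import structures.
From mathcomp Require Import all_boot all_order all_algebra.
From mathcomp Require Import all_classical all_reals all_analysis.

Set Implicit Arguments.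
Unset Strict Implicit.
Unset Printing Implicit Defensive.

Import Order.TTheory GRing.Theory Num.Theory.
Import numFieldNormedType.Exports.

Local Open Scope classical_set_scope.
Local Open Scope ring_scope.

Section Euclidean.
Context {R : realType} {n : nat}.
Implicit Types (u v x : 'cV[R]_n) (f : 'cV[R]_n -> R).

Definition dotv u v : R := (u^T *m v) 0 0.

(* The library norm `|u| on matrices is the sup norm; it induces the same
   topology, bounded sets and Lipschitz functions as [enorm]. *)
Definition enorm u : R := Num.sqrt (dotv u u).

Definition grad f x : 'cV[R]_n := \col_i 'D_(delta_mx i 0) f x.

Definition hess f x : 'M[R]_n :=
  \matrix_(i, j) 'D_(delta_mx j 0) ('D_(delta_mx i 0) f) x.

Definition C1 f : Prop :=
  (forall x, differentiable f x) /\ continuous (grad f).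

Definition C2_near f x : Prop :=
  \forall z \near x, [/\ differentiable f z, differentiable (grad f) z
                       & {for z, continuous (hess f)}].

Definition local_min f x : Prop := \forall z \near x, f x <= f z.

Definition superlinear (x : nat -> 'cV[R]_n) (a : 'cV[R]_n) : Prop :=
  (fun k => enorm (x k.+1 - a) / enorm (x k - a)) @ \oo --> (0 : R).

End Euclidean.

Record tbb_param (R : realType) := TBBParam {
  mu1 : R; mu2 : R;
  gamma1 : R; gamma2 : R;
  sigma1 : R; sigma2 : R;
  alpha_min : R; alpha_max : R;
  omega : R;
  mu1_itv : 0 < mu1 < 1;
  mu2_itv : 0 < mu2 < 1;
  mu1_le_mu2 : mu1 <= mu2;
  gamma1_gt0 : 0 < gamma1;
  gamma2_gt0 : 0 < gamma2;
  sigma1_itv : 0 < sigma1 < 1;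
  sigma2_itv : 1 < sigma2 < 2;
  alpha_min_gt0 : 0 < alpha_min;
  alpha_min_lt_max : alpha_min < alpha_max;
  omega_itv : 0 < omega < 1 }.

Inductive tbb_variant := BB1 | BB2 | TBB1 | TBB2 | TBB1' | TBB2'.

Section StepSize.
Context {R : realType} {n : nat}.
Variables (f : 'cV[R]_n -> R) (x : nat -> 'cV[R]_n) (k : nat).

(* Meant for k >= 1, with s1, y1, s2, y2 standing for s_{k-1}, y_{k-1},
   s_{k-2}, y_{k-2}.  Since 1.-2 = 0, truncation at k = 1 implements the
   convention x_{-1} = x_0. *)
Definition s1 := x k - x k.-1.
Definition s2 := x k - x k.-2.
Definition y1 := grad f (x k) - grad f (x k.-1).
Definition y2 := grad f (x k) - grad f (x k.-2).

Definition alphaBB1 : R := enorm s1 ^+ 2 / dotv s1 y1.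
Definition alphaBB2 : R := dotv s1 y1 / enorm y1 ^+ 2.
Definition beta : R := dotv s1 y1 / enorm y1 ^+ 2.

Definition lambdaTBB1' : R :=
  (enorm s2 ^+ 2 / dotv y2 s2 - alphaBB2) / (alphaBB1 - alphaBB2).
Definition lambdaTBB2' : R :=
  (dotv y2 s2 / enorm y2 ^+ 2 - alphaBB2) / (alphaBB1 - alphaBB2).

Definition alpha (v : tbb_variant) : R :=
  match v with
  | BB1 => alphaBB1
  | BB2 => alphaBB2
  | TBB1 => (enorm s1 ^+ 2 + enorm s2 ^+ 2) / (dotv s1 y1 + dotv s2 y2)
  | TBB2 => (dotv s1 y1 + dotv s2 y2) / (enorm y1 ^+ 2 + enorm y2 ^+ 2)
  | TBB1' => lambdaTBB1' * alphaBB1 + (1 - lambdaTBB1') * alphaBB2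
  | TBB2' => lambdaTBB2' * alphaBB1 + (1 - lambdaTBB2') * alphaBB2
  end.

(* No denominator occurring in [beta] or in [alpha v] vanishes. *)
Definition step_size_defined (v : tbb_variant) : Prop :=
  enorm y1 ^+ 2 != 0 /\
  match v with
  | BB1 => dotv s1 y1 != 0
  | BB2 => True
  | TBB1 => dotv s1 y1 + dotv s2 y2 != 0
  | TBB2 => enorm y1 ^+ 2 + enorm y2 ^+ 2 != 0
  | TBB1' => [/\ dotv s1 y1 != 0, dotv y2 s2 != 0 & alphaBB1 - alphaBB2 != 0]
  | TBB2' => [/\ dotv s1 y1 != 0, enorm y2 ^+ 2 != 0
                & alphaBB1 - alphaBB2 != 0]
  end.

Definition safeguard (P : tbb_param R) (a : R) : R :=
  let lo := Num.max (alpha_min P) (sigma1 P * `|beta|) in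
  let hi := Num.min (alpha_max P) (sigma2 P * `|beta|) in
  if lo <= a <= hi then a else if a < lo then lo else hi.

End StepSize.

Section Algorithm.
Context {R : realType} {n : nat}.
Variables (P : tbb_param R) (f : 'cV[R]_n -> R).

(* g^T d + (1 / (2 abar)) L ||d||^2 with g = grad f z, for abar = a and L = l *)
Definition armijo_slope (z d : 'cV[R]_n) (a l : R) : R :=
  dotv (grad f z) d + (2 * a)^-1 * l * enorm d ^+ 2.

Definition armijo_accept (z d : 'cV[R]_n) (a l t : R) : Prop :=
  f (z + t *: d) <= f z + mu1 P * t * armijo_slope z d a l /\
  (gamma1 P <= t \/
   exists ts : R,
     [/\ gamma2 P * ts <= t, 0 < gamma2 P * ts
       & f z + mu2 P * ts * armijo_slope z d a l < f (z + ts *: d)]).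

(* [x], [abar], [L], [p] are the sequences x_k, \bar\alpha_k, L_k, p_k of an
   infinite run started at [x0]; the step length lambda_k is omega ^+ p k. *)
Record tbb_run (v : tbb_variant) (x0 : 'cV[R]_n) (x : nat -> 'cV[R]_n)
    (abar L : nat -> R) (p : nat -> nat) : Prop := TBBRun {
  run_x0 : x 0%N = x0;
  run_abar0 : abar 0%N = 1;
  run_no_stop : forall k, grad f (x k) != 0;
  run_L : forall k, let g := grad f (x k) in let d := - abar k *: g in
    0 <= L k <= abar k * (- dotv g d) / enorm d ^+ 2;
  run_line_search : forall k, let d := - abar k *: grad f (x k) in
    armijo_accept (x k) d (abar k) (L k) (omega P ^+ p k) /\
    forall q, (q < p k)%N ->
      ~ armijo_accept (x k) d (abar k) (L k) (omega P ^+ q);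
  run_step : forall k,
    x k.+1 = x k + omega P ^+ p k *: (- abar k *: grad f (x k));
  run_defined : forall k, (0 < k)%N -> step_size_defined f x k v;
  run_abar : forall k, (0 < k)%N ->
    abar k = safeguard f x k P (alpha f x k v) }.

End Algorithm.

(* Main.v *)
Require Import Defs.
From HB Require Import structures.
From mathcomp Require Import all_boot all_order all_algebra.
From mathcomp Require Import all_classical all_reals all_analysis.
From mathcomp Require Import ring lra.

Set Implicit Arguments.
Unset Strict Implicit.
Unset Printing Implicit Defensive.

Import Order.TTheory GRing.Theory Num.Theory.
Import numFieldNormedType.Exports.
Local Open Scope classical_set_scope.
Local Open Scope ring_scope.

(** Write g for the gradient of f, G for the Hessian at the limit xs,
    e_k = x_k - xs for the error, s_k = x_{k+1} - x_k for the step, and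
    t_k = lambda_k abar_k.  The bounds on beta_k keep the safeguarded step
    size positive, so t_k > 0 and s_k = - t_k g(x_k) is a quasi-Newton step with
    matrix t_k^-1 I.  The equivalence is the Dennis-More characterization of
    superlinear convergence for such steps ([dennis_more]).

    The residual of the quasi-Newton model is
      (t_k^-1 I - G) s_k = (g(x_{k+1}) - g(x_k) - G s_k) - g(x_{k+1}),
    and the bracket is o(s_k) because the gradient is strictly differentiable
    at xs ([grad_strictly_differentiable]: the Hessian is continuous there, so
    the mean value inequality applies on small segments).  Hence the residual
    is o(s_k) exactly when g(x_{k+1}) is.  Since g(xs) = 0
    ([grad_local_min]) and G is bounded and bounded below
    ([quadratic_form_coercive]), g(x_{k+1}) and e_{k+1} have the same order of
    magnitude ([value_bigO_error], [error_bigO_value]), so this says that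
    e_{k+1} = o(s_k).  Finally, e_{k+1} is negligible before s_k if and only if
    it is negligible before e_k, because in either case s_k and e_k have the
    same order of magnitude ([next_littleoP]).

    The estimates are carried out for the sup norm, for which matrices form a
    normed module; [enorm_ratio_cvg0P] passes from ratios of Euclidean norms
    to little-o relations for it. *)

(** * Norms of matrices *)

Lemma mx_norm_ge_coef (K : realDomainType) (m n : nat) (A : 'M[K]_(m, n)) i j :
  `|A i j| <= `|A|.
Proof.
rewrite [leRHS]/Num.norm/= mx_normrE.
exact: (le_bigmax _ (fun ij => `|A ij.1 ij.2|) (i, j)).
Qed.

Lemma mx_norm_le (K : realDomainType) (m n : nat) (A : 'M[K]_(m, n)) (c : K) :
  0 <= c -> (forall i j, `|A i j| <= c) -> `|A| <= c.
Proof.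
move=> c0 Ac; rewrite [leLHS]/Num.norm/= mx_normrE.
by apply/bigmax_leP; split=> // ij _; exact: Ac.
Qed.

Lemma mx_norm_mulmx_le (K : realDomainType) (m n k : nat)
    (A : 'M[K]_(m, n)) (B : 'M[K]_(n, k)) : `|A *m B| <= n%:R * `|A| * `|B|.
Proof.
apply: mx_norm_le => [|i j]; first by rewrite !mulr_ge0.
rewrite mxE (le_trans (ler_norm_sum _ _ _))//.
apply: (@le_trans _ _ (\sum_(l < n) `|A| * `|B|)).
  by apply: ler_sum => l _; rewrite normrM ler_pM// mx_norm_ge_coef.
by rewrite sumr_const card_ord -mulrA mulr_natl.
Qed.

Lemma dotv_le (R : realType) (n : nat) (u v : 'cV[R]_n) :
  `|dotv u v| <= n%:R * `|u| * `|v|.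
Proof.
rewrite /dotv mxE (le_trans (ler_norm_sum _ _ _))//.
apply: (@le_trans _ _ (\sum_(l < n) `|u| * `|v|)).
  by apply: ler_sum => l _; rewrite normrM mxE ler_pM// mx_norm_ge_coef.
by rewrite sumr_const card_ord -mulrA mulr_natl.
Qed.

Lemma norm_le_enorm (R : realType) (n : nat) (u : 'cV[R]_n) : `|u| <= enorm u.
Proof.
apply: mx_norm_le => [|i j]; first exact: sqrtr_ge0.
rewrite ord1 -sqrtr_sqr ler_wsqrtr// /dotv mxE (bigD1 i)//= mxE -expr2 lerDl.
by apply: sumr_ge0 => l _; rewrite mxE -expr2 sqr_ge0.
Qed.

Lemma enorm_le_norm (R : realType) (n : nat) (u : 'cV[R]_n) :
  enorm u <= Num.sqrt n%:R * `|u|.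
Proof.
have -> : `|u| = Num.sqrt (`|u| ^+ 2) by rewrite sqrtr_sqr normr_id.
rewrite -sqrtrM// ler_wsqrtr// expr2 mulrA.
exact: le_trans (ler_norm _) (dotv_le _ _).
Qed.

(** * Ratios of norms and little-o *)

(** Both norms are equivalent, so little-o for the sup norm is convergence to 0
    of the Euclidean ratio; a zero of [v] would make the ratio 0 whatever [u]
    is. *)
Lemma enorm_ratio_cvg0P (R : realType) (n : nat) (u v : nat -> 'cV[R]_n) :
  (forall k, v k != 0) ->
  (fun k => enorm (u k) / enorm (v k)) @ \oo --> (0 : R) <-> u =o_\oo v.
Proof.
move=> v0.
have ev0 k : 0 < enorm (v k).
  by rewrite (lt_le_trans _ (norm_le_enorm _))// normr_gt0.
pose c : R := 1 + Num.sqrt n%:R.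
have c0 : 0 < c by rewrite ltr_wpDr// sqrtr_ge0.
have cle (w : 'cV[R]_n) : enorm w <= c * `|w|.
  by rewrite (le_trans (enorm_le_norm _))// /c mulrDl mul1r lerDr.
split.
- move=> /cvgr0Pnorm_le uv; apply/eqoP => e e0.
  have /uv : 0 < e / c by rewrite divr_gt0.
  apply: filterS => k.
  rewrite ger0_norm; last by rewrite divr_ge0// sqrtr_ge0.
  rewrite ler_pdivrMr// => le_uv; rewrite (le_trans (norm_le_enorm _))//.
  rewrite (le_trans le_uv)// -mulrA ler_wpM2l// ?(ltW e0)//.
  by rewrite ler_pdivrMl.
- move=> /eqoP uv; apply/cvgr0Pnorm_le => e e0.
  have /uv : 0 < e / c by rewrite divr_gt0.
  apply: filterS => k le_uv.
  rewrite ger0_norm; last by rewrite divr_ge0// sqrtr_ge0.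
  rewrite ler_pdivrMr// (le_trans (cle _))//.
  rewrite -ler_pdivlMl// mulrA (mulrC c^-1) (le_trans le_uv)//.
  by rewrite ler_wpM2l ?norm_le_enorm// divr_ge0// ltW.
Qed.

(** If [u] is eventually at most half of [v], then [u - v] keeps at least half
    of it. *)
Lemma littleo_bigO_sub (K : realFieldType) (T : Type) (V : normedModType K)
    (F : filter_on T) (u v : T -> V) : u =o_F v -> v =O_F (u - v).
Proof.
move=> /eqoP uv; apply/eqO_exP; exists 2 => //.
have /uv : 0 < 2^-1 :> K by [].
apply: filterS => t le_uv.
have := ler_distD (u t) 0 (v t).
rewrite !sub0r !normrN /= => tri; have : `|(u - v) t| = `|u t - v t| by [].
by move=> ->; lra.
Qed.

Lemma littleo_bigO_trans (K : numFieldType) (T : Type)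
    (U V W : normedModType K) (F : filter_on T)
    (u : T -> U) (v : T -> V) (w : T -> W) :
  u =o_F v -> v =O_F w -> u =o_F w.
Proof. by move=> -> vw; apply: eqoE; rewrite (littleo_bigO_eqo w). Qed.

Lemma bigO_littleo_trans (K : numFieldType) (T : Type)
    (U V W : normedModType K) (F : filter_on T)
    (u : T -> U) (v : T -> V) (w : T -> W) :
  u =O_F v -> v =o_F w -> u =o_F w.
Proof. by move=> -> vw; apply: eqoE; rewrite (bigO_littleo_eqo w). Qed.

Lemma littleoB (K : numFieldType) (T : Type) (V W : normedModType K)
    (F : filter_on T) (u v : T -> V) (e : T -> W) :
  u =o_F e -> v =o_F e -> (u - v) =o_F e.
Proof. by move=> ue ve; apply: add2o => //; rewrite ve oppo. Qed.

(** In each direction the assumption makes the error [e k] and the step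
    [e k.+1 - e k] comparable, because they differ only by the negligible term
    [e k.+1]. *)
Lemma next_littleoP (K : realFieldType) (V : normedModType K) (e : nat -> V) :
  (fun k => e k.+1) =o_\oo e <->
  (fun k => e k.+1) =o_\oo (fun k => e k.+1 - e k).
Proof.
split=> le_e.
- exact: littleo_bigO_trans le_e (littleo_bigO_sub le_e).
- apply: littleo_bigO_trans (le_e) _.
  rewrite [X in _ =O_\oo X](_ : _ =
    (fun k => e k.+1) - (fun k => e k.+1 - e k)).
    exact: littleo_bigO_sub le_e.
  by apply/funext => k /=; rewrite !fctE opprB addrC subrK.
Qed.

(** * Strict differentiability of the gradient *)

(** The difference quotients of [F] along the line and those of the
    restriction of [F] to the line are the same functions. *)
Lemma is_derive_line (K : numFieldType) (V W : normedModType K) (F : V -> W)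
    (x h : V) (t : K) : derivable F (x + t *: h) h ->
  is_derive t 1 (fun t => F (x + t *: h)) ('D_h F (x + t *: h)).
Proof.
move=> dF; have eqF :
    (fun s : K => s^-1 *: (((fun t => F (x + t *: h)) \o shift t) (s *: 1)
                           - F (x + t *: h))) =
    (fun s : K => s^-1 *: ((F \o shift (x + t *: h)) (s *: h)
                           - F (x + t *: h))).
  apply/funext => s /=; congr (_ *: (F _ - _)).
  by rewrite [_ *: 1]mulr1 scalerDl addrCA.
by split; rewrite /derivable /derive eqF.
Qed.

(** There is no mean value equality for vector-valued maps, but for the sup norm
    the inequality follows from the scalar theorem applied to each coordinate:
    the intermediate point may depend on the coordinate. *)
Lemma mean_value_inequality (R : realType) (V : normedModType R) (m n : nat)
    (F : V -> 'M[R]_(m, n)) (x h : V) (w : 'M[R]_(m, n)) (c : R) :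
  (forall t : R, t \in `[0, 1] -> derivable F (x + t *: h) h) ->
  (forall t : R, t \in `[0, 1] -> `|'D_h F (x + t *: h) - w| <= c) ->
  `|F (x + h) - F x - w| <= c.
Proof.
move=> dF Fc.
have c0 : 0 <= c.
  by apply: le_trans (Fc 0 _); rewrite ?in_itv/= ?lexx ?ler01.
apply: mx_norm_le => // i j.
have dFij (t : R) : t \in `[0, 1] ->
    is_derive t 1 (fun t => F (x + t *: h) i j) ('D_h F (x + t *: h) i j).
  move=> t01; rewrite derive_mx ?mxE; last exact: dF.
  apply: (is_derive_line (F := fun z => F z i j)).
  by have /derivable_mxP := dF t t01; apply.
pose phi (t : R) : R := F (x + t *: h) i j.
pose dphi (t : R) : R := 'D_h F (x + t *: h) i j.
have dphiP (t : R) : t \in `]0, 1[ -> is_derive t 1 phi (dphi t).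
  by move=> t01; apply: dFij; exact: subset_itv_oo_cc.
have cphi : {within `[0, 1], continuous phi}.
  by apply: derivable_within_continuous => t /dFij[].
have [t t01] := MVT_segment ler01 dphiP cphi.
rewrite /phi /dphi subr0 mulr1 scale1r scale0r addr0 => FE.
rewrite !mxE FE (le_trans _ (Fc t t01))//.
by rewrite (le_trans _ (mx_norm_ge_coef _ i j))// !mxE.
Qed.

(** [hess] is made of partial derivatives of partial derivatives; for a
    differentiable gradient it is therefore its Jacobian matrix. *)
Lemma derive_grad (R : realType) (n : nat) (f : 'cV[R]_n -> R)
    (z h : 'cV[R]_n) :
  differentiable (grad f) z -> 'D_h (grad f) z = hess f z *m h.
Proof.
move=> dg; rewrite deriveE//.
rewrite [in LHS](matrix_sum_delta h) linear_sum /=.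
apply/matrixP => i j; rewrite ord1 summxE mxE; apply: eq_bigr => k _.
rewrite big_ord1 linearZ /= mxE mulrC mxE; congr (_ * _).
rewrite -deriveE// derive_mx ?mxE; last exact: diff_derivable.
by congr ('D_ _ _ _); apply/funext => y; rewrite mxE.
Qed.

Lemma grad_local_min (R : realType) (n : nat) (f : 'cV[R]_n -> R)
    (a : 'cV[R]_n) :
  (forall z, differentiable f z) -> local_min f a -> grad f a = 0.
Proof.
move=> df mina; apply/matrixP => i j; rewrite !mxE.
set e := delta_mx i 0.
have dline (t : R) :
    is_derive t 1 (fun t => f (a + t *: e)) ('D_e f (a + t *: e)).
  exact/is_derive_line/diff_derivable.
have : \forall t \near (0 : R), f a <= f (a + t *: e).
  have cvga : a + t *: e @[t --> (0 : R)] --> a.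
    rewrite -[X in _ --> X]addr0 -(scale0r e).
    by apply: cvgD; [exact: cvg_cst|apply: cvgZr_tmp; exact: cvg_id].
  exact: cvga mina.
move=> /nbhs_ballP[r /= r0 minr].
have : is_derive (0 : R) 1 (fun t => f (a + t *: e)) 0.
  apply: (@derive1_at_min _ _ (- r) r); rewrite ?in_itv/=.
  - by rewrite ge0_cp// ltW.
  - by move=> t _; case: (dline t).
  - by rewrite oppr_lt0 r0.
  - move=> t; rewrite in_itv/= => tr; rewrite scale0r addr0.
    by apply: minr; rewrite /ball/= sub0r normrN ltr_norml.
move=> [_ <-]; have [_ ->] := dline 0.
by rewrite scale0r addr0.
Qed.

(** Both points vary, unlike in differentiability at [a]: the residual of the
    quasi-Newton model compares two consecutive iterates, neither of which
    is [a]. *)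
Definition strictly_differentiable (R : realType) (n : nat)
    (F : 'cV[R]_n -> 'cV[R]_n) (a : 'cV[R]_n) (A : 'M[R]_n) : Prop :=
  (fun z : 'cV[R]_n * 'cV[R]_n => F z.1 - F z.2 - A *m (z.1 - z.2))
  =o_ (a, a) (fun z => z.1 - z.2).

(** On a small ball the Hessian is close to its value at [a]; the ball is convex,
    so the mean value inequality can be used between any two of its points. *)
Lemma grad_strictly_differentiable (R : realType) (n : nat)
    (f : 'cV[R]_n -> R) (a : 'cV[R]_n) : C2_near f a ->
  strictly_differentiable (grad f) a (hess f a).
Proof.
move=> C2f; apply/eqoP => e e0.
(* The factor n of [mx_norm_mulmx_le] is raised to n + 1, which is never 0. *)
pose c : R := n.+1%:R.
have ec0 : 0 < e / c by rewrite divr_gt0.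
have [_ _ /cvgrPdist_le /(_ _ ec0) hess_close] := nbhs_singleton C2f.
have /nbhs_ballP[r /= r0 near_a] : \forall z \near a,
    differentiable (grad f) z /\ `|hess f a - hess f z| <= e / c.
  by apply: filterS2 C2f hess_close => z [].
have : nbhs (a, a) (ball a r `*` ball a r).
  by exists (ball a r, ball a r) => //; split; exact: nbhsx_ballx.
apply: filterS => -[z1 z2] [/=]; rewrite -!ball_normE/= => az1 az2.
set h := z1 - z2.
have seg (t : R) : t \in `[0, 1] -> ball a r (z2 + t *: h).
  rewrite in_itv/= => /andP[t0 t1].
  have z2E : a - (z2 + t *: h) = (1 - t) *: (a - z2) + t *: (a - z1).
    by apply/matrixP => i j; rewrite /h !mxE; ring.
  rewrite -ball_normE/= z2E (le_lt_trans (ler_normD _ _))// !normrZ.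
  rewrite !ger0_norm ?subr_ge0//.
  rewrite (@le_lt_trans _ _ (Num.max `|a - z1| `|a - z2|)) ?gt_max ?az1//.
  set M := Num.max _ _.
  have -> : M = (1 - t) * M + t * M by ring.
  by rewrite lerD// ler_wpM2l ?subr_ge0// le_max lexx ?orbT.
have -> : z1 = z2 + h by rewrite addrC subrK.
apply: mean_value_inequality => t /seg /near_a[dg close].
  exact: diff_derivable.
rewrite derive_grad//= -mulmxBl (le_trans (mx_norm_mulmx_le _ _))//.
rewrite ler_wpM2r// distrC.
apply: (@le_trans _ _ (c * (e / c))); last by rewrite mulrC divfK// pnatr_eq0.
by rewrite ler_pM// ler_nat.
Qed.

Lemma strictly_differentiable_seq (R : realType) (n : nat)
    (F : 'cV[R]_n -> 'cV[R]_n) (a : 'cV[R]_n) (A : 'M[R]_n)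
    (y z : nat -> 'cV[R]_n) :
  strictly_differentiable F a A -> y @ \oo --> a -> z @ \oo --> a ->
  (fun k => F (y k) - F (z k) - A *m (y k - z k))
  =o_\oo (fun k => y k - z k).
Proof.
move=> /eqoP dF ya za; apply/eqoP => e e0.
have yz : (y k, z k) @[k --> \oo] --> (a, a).
  exact: (@cvg_pair _ _ _ \oo (nbhs a) (nbhs a) _
    (nbhs_filter a) (nbhs_filter a)).
exact: yz (dF e e0).
Qed.

(** * The Dennis-More characterization *)

(** For a zero [a] of [F] at which the derivative [A] is bounded below, the value
    of [F] measures the distance to [a] in both directions. *)
Section DennisMore.
Variables (R : realType) (n : nat) (F : 'cV[R]_n -> 'cV[R]_n).
Variables (a : 'cV[R]_n) (A : 'M[R]_n) (m : R).
Hypotheses (dF : strictly_differentiable F a A) (Fa0 : F a = 0).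
Hypotheses (m0 : 0 < m) (A_ge : forall w : 'cV[R]_n, m * `|w| <= `|A *m w|).

Lemma zero_linearization (y : nat -> 'cV[R]_n) : y @ \oo --> a ->
  (fun k => A *m (y k - a) - F (y k)) =o_\oo (fun k => y k - a).
Proof.
move=> ya.
have cst_a : (fun=> a) @ \oo --> a by exact: cvg_cst.
have /eqoP := strictly_differentiable_seq dF ya cst_a.
rewrite Fa0 => Fo; apply/eqoP => e /Fo; apply: filterS => k.
by rewrite subr0 distrC.
Qed.

Lemma value_bigO_error (y : nat -> 'cV[R]_n) : y @ \oo --> a ->
  (fun k => F (y k)) =O_\oo (fun k => y k - a).
Proof.
move=> /zero_linearization/eqoP /(_ 1 ltr01) near_lin.
apply/eqO_exP; exists (1 + n%:R * `|A|); first by rewrite ltr_wpDr ?mulr_ge0.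
apply: filterS near_lin => k /= lin_le.
have := ler_distD (A *m (y k - a)) 0 (F (y k)).
have := mx_norm_mulmx_le A (y k - a).
by rewrite !sub0r !normrN; lra.
Qed.

Lemma error_bigO_value (y : nat -> 'cV[R]_n) : y @ \oo --> a ->
  (fun k => y k - a) =O_\oo (fun k => F (y k)).
Proof.
move=> /zero_linearization/eqoP lin.
(* Eventually the linearization error takes away at most half of [m]. *)
have m20 : 0 < m / 2 by rewrite divr_gt0.
apply/eqO_exP; exists (2 / m); first by rewrite divr_gt0.
apply: filterS (lin _ m20) => k /= lin_le.
have := ler_distD (F (y k)) 0 (A *m (y k - a)).
have := A_ge (y k - a).
rewrite !sub0r !normrN => ge_m le_tri.
rewrite -ler_pdivrMl ?divr_gt0// invf_div.
rewrite distrC in le_tri; lra.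
Qed.

(** The residual is a term that is always o(step) minus [F (x k.+1)]; the latter
    has the order of magnitude of the next error. *)
Lemma dennis_more (x : nat -> 'cV[R]_n) (t : nat -> R) :
  x @ \oo --> a -> (forall k, t k != 0) ->
  (forall k, x k.+1 = x k - t k *: F (x k)) ->
  (fun k => x k.+1 - a) =o_\oo (fun k => x k - a) <->
  (fun k => ((t k)^-1%:M - A) *m (x k.+1 - x k))
  =o_\oo (fun k => x k.+1 - x k).
Proof.
move=> xa t0 xS.
have xSa : (fun k => x k.+1) @ \oo --> a by rewrite cvg_shiftS.
have residual := strictly_differentiable_seq dF xSa xa.
have residualE k : ((t k)^-1%:M - A) *m (x k.+1 - x k) =
    (F (x k.+1) - F (x k) - A *m (x k.+1 - x k)) - F (x k.+1).
  rewrite mulmxBl mul_scalar_mx {1}xS addrAC subrr add0r scalerN scalerA.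
  by rewrite mulVf// scale1r addrAC [F _ - F _]addrC addrK.
have errorE :
    (fun k => (x k.+1 - a) - (x k - a)) = (fun k => x k.+1 - x k).
  by apply/funext => k; rewrite opprB addrA subrK.
rewrite (next_littleoP (fun k => x k - a)) errorE.
split=> small.
- have -> : (fun k => ((t k)^-1%:M - A) *m (x k.+1 - x k)) =
      (fun k => F (x k.+1) - F (x k) - A *m (x k.+1 - x k))
      - (fun k => F (x k.+1)).
    by apply/funext => k; rewrite residualE.
  apply: littleoB => //.
  exact: bigO_littleo_trans (value_bigO_error xSa) small.
- apply: bigO_littleo_trans (error_bigO_value xSa) _.
  have -> : (fun k => F (x k.+1)) =
      (fun k => F (x k.+1) - F (x k) - A *m (x k.+1 - x k))
      - (fun k => ((t k)^-1%:M - A) *m (x k.+1 - x k)).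
    by apply/funext => k /=; rewrite !fctE residualE opprB addrC subrK.
  exact: littleoB.
Qed.

End DennisMore.

(** The lower bound on the quadratic form and the estimate of the scalar product
    by the norms of its factors leave one power of the norm of [w] to cancel.
    The denominator n + 1 keeps the constant positive in every dimension. *)
Lemma quadratic_form_coercive (R : realType) (n : nat) (A : 'M[R]_n) (m : R)
    (w : 'cV[R]_n) :
  0 <= m -> m * enorm w ^+ 2 <= dotv w (A *m w) ->
  m / n.+1%:R * `|w| <= `|A *m w|.
Proof.
move=> m0 quad.
have [->|w0] := eqVneq w 0; first by rewrite normr0 mulr0.
have w_gt0 : 0 < `|w| by rewrite normr_gt0.
have : m * `|w| ^+ 2 <= n%:R * `|w| * `|A *m w|.
  apply: le_trans (le_trans quad (le_trans (ler_norm _) (dotv_le _ _))).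
  by rewrite ler_wpM2l// lerXn2r ?nnegrE ?norm_le_enorm ?sqrtr_ge0.
rewrite expr2 mulrA [leRHS]mulrAC (ler_pM2r w_gt0) => le_n.
rewrite mulrAC ler_pdivrMr// (le_trans le_n)// mulrC ler_wpM2l// ler_nat.
by rewrite leqnSn.
Qed.

(** The safeguarded value is one of the two clipping bounds or lies above the
    lower one, and both bounds are positive. *)
Lemma safeguard_gt0 (R : realType) (n : nat) (f : 'cV[R]_n -> R)
    (x : nat -> 'cV[R]_n) (k : nat) (P : tbb_param R) (s : R) :
  0 < beta f x k -> 0 < safeguard f x k P s.
Proof.
move=> beta_gt0; rewrite /safeguard.
have amin0 := alpha_min_gt0 P.
have lo0 : 0 < Num.max (alpha_min P) (sigma1 P * `|beta f x k|).
  by rewrite lt_max amin0.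
have hi0 : 0 < Num.min (alpha_max P) (sigma2 P * `|beta f x k|).
  have /andP[sigma2_gt1 _] := sigma2_itv P.
  rewrite lt_min (lt_trans amin0 (alpha_min_lt_max P))/=.
  by rewrite mulr_gt0 ?normr_gt0 ?gt_eqF// (lt_trans ltr01).
case: ifP => [/andP[lo_s _]|_]; first exact: lt_le_trans lo_s.
by case: ifP.
Qed.

Theorem theorem4 (R : realType) (n : nat) (f : 'cV[R]_n -> R)
    (P : tbb_param R) (v : tbb_variant)
    (x0 : 'cV[R]_n) (x : nat -> 'cV[R]_n) (abar L : nat -> R) (p : nat -> nat)
    (xs : 'cV[R]_n)
    (f_C1 : C1 f)
    (run : tbb_run P f v x0 x abar L p)
    (beta_bounds : forall k, (0 < k)%N ->
      alpha_min P <= beta f x k <= alpha_max P)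
    (alpha_bounds : alpha_min P <= 1 <= alpha_max P)
    (x_cvg : x @ \oo --> xs)
    (xs_min : local_min f xs)
    (x_neq : forall k, x k <> xs)
    (level_bounded : bounded_set [set z | f z <= f x0])
    (f_C2 : C2_near f xs)
    (hess_bounds : exists eps m M : R, [/\ 0 < eps, 0 < m, m < M &
      forall z, enorm (z - xs) < eps -> forall y : 'cV[R]_n,
        m * enorm y ^+ 2 <= dotv y (hess f z *m y) <= M * enorm y ^+ 2])
    (hess_lipschitz : exists2 U : set 'cV[R]_n, nbhs xs U &
      [lipschitz hess f z | z in U]) :
  superlinear x xs <->
  (fun k => enorm (((omega P ^+ p k * abar k)^-1%:M - hess f xs)
                     *m (x k.+1 - x k))
            / enorm (x k.+1 - x k)) @ \oo --> (0 : R).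
Proof.
pose t k := omega P ^+ p k * abar k.
have t0 k : t k != 0.
  have /andP[omega0 _] := omega_itv P.
  rewrite mulf_neq0 ?expf_neq0 ?gt_eqF//.
  case: k => [|k]; first by rewrite (run_abar0 run).
  rewrite (run_abar run)// safeguard_gt0//.
  have /andP[beta_min _] := beta_bounds k.+1 isT.
  exact: lt_le_trans (alpha_min_gt0 P) beta_min.
have xS k : x k.+1 = x k - t k *: grad f (x k).
  by rewrite (run_step run) scaleNr scalerN scalerA.
have error_neq0 k : x k - xs != 0 by rewrite subr_eq0; exact/eqP.
have step_neq0 k : x k.+1 - x k != 0.
  rewrite xS addrAC subrr add0r oppr_eq0 scaler_eq0 negb_or t0.
  exact: run_no_stop run k.
have [eps [m [M [eps0 m0 _ hess_quad]]]] := hess_bounds.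
have hess_ge (w : 'cV[R]_n) : m / n.+1%:R * `|w| <= `|hess f xs *m w|.
  apply: quadratic_form_coercive (ltW m0) _.
  have /hess_quad/(_ w)/andP[] // : enorm (xs - xs) < eps.
  by rewrite subrr /enorm /dotv mulmx0 mxE sqrtr0.
have grad0 := grad_local_min f_C1.1 xs_min.
have mn0 : 0 < m / n.+1%:R by rewrite divr_gt0.
rewrite /superlinear !enorm_ratio_cvg0P//.
exact (dennis_more (grad_strictly_differentiable f_C2) grad0 mn0 hess_ge
  x_cvg t0 xS).
Qed.
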